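(* Let $n,m$ be positive integers and let $R=M_n(\mathbb{Z}_m)$ be the $*$-ring of $n\times n$ matrices over $\mathbb{Z}_m$ with transposition of matrices as involution. Then $\Gamma'(R)$ is connected. Moreover, $\operatorname{diam}(\Gamma'(R))=2$ and $\operatorname{gr}(\Gamma'(R))=3$.
   Context: $Z^*(R)$ denotes the set of all non-zero zero-divisors of $R$ (left or right). For a ring $R$ with involution $*$, the generalized zero-divisor graph $\Gamma'(R)$ is the simple undirected graph with vertex set $Z^*(R)$ in which two distinct vertices $x,y$ are adjacent if and only if $x^ky^*=0$ or $y^kx^*=0$ for some positive integer $k$. The distance $d(x,y)$ is the length of a shortest path from $x$ to $y$ ($\infty$ if there is none); $\operatorname{diam}(G)$ is the supremum of $d(x,y)$ over all vertices $x,y$ of $G$; the girth $\operatorname{gr}(G)$ is the length of a shortest cycle in $G$ ($\infty$ if $G$ has no cycle).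
   Formalization: The claim fails for m=1 (no vertices) and for some m when n=1 (Z_4 has one vertex, diameter 0); so m≥2 is assumed, and for n=1 diameter 2 and girth 3 are claimed only when m has two distinct prime divisors and is divisible by the square of a prime. *)

(* Defs.v *)
From HB Require Import structures.
From mathcomp Require Import all_boot all_order all_algebra.
From mathcomp Require Import boolp.

Set Implicit Arguments.
Unset Strict Implicit.
Unset Printing Implicit Defensive.

Import GRing.Theory.

(* [option nat] stands for the natural numbers extended by [None] = infinity. *)
Definition enat_le (a b : option nat) : bool :=
  match a, b with
  | _, None => true
  | None, Some _ => false
  | Some i, Some j => i <= j
  end.

(* Infimum of a set of natural numbers; the empty set has infimum infinity. *)
Definition nat_inf (P : nat -> Prop) : option nat :=
  match pselect (exists k, (fun i => `[< P i >]) k) with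
  | left h => Some (ex_minn h)
  | right _ => None
  end.

(* Supremum: the least upper bound; the empty set has supremum 0. *)
Definition enat_sup (S : option nat -> Prop) : option nat :=
  nat_inf (fun k => forall d, S d -> enat_le d (Some k)).

Record sgraph := SGraph {
  vertex : eqType;
  edge : rel vertex;
  edge_sym : symmetric edge;
  edge_irr : irreflexive edge }.

Section GraphInvariants.
Variable G : sgraph.
Implicit Types x y : vertex G.

Definition is_path_from_to x y (p : seq (vertex G)) : bool :=
  [&& path (@edge G) x p, last x p == y & uniq (x :: p)].

Definition connected_graph : Prop :=
  forall x y, exists p, is_path_from_to x y p.

Definition dist x y : option nat :=
  nat_inf (fun k => exists2 p, is_path_from_to x y p & size p = k).

Definition diam : option nat :=
  enat_sup (fun d => exists x y, d = dist x y).

Definition girth : option nat :=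
  nat_inf (fun k => exists2 c : seq (vertex G),
    ucycle (@edge G) c & 3 <= size c /\ size c = k).

End GraphInvariants.

Local Open Scope ring_scope.

Record involution (R : pzRingType) := Involution {
  star :> R -> R;
  starD : forall x y, star (x + y) = star x + star y;
  starM : forall x y, star (x * y) = star y * star x;
  starK : involutive star }.

Section ZeroDivisorGraph.
Variables (R : pzRingType) (s : involution R).

Definition nonzero_zero_divisor : pred R := fun x =>
  (x != 0) && `[< exists y : R, y != 0 /\ (x * y = 0 \/ y * x = 0) >].

Definition zdg_vertex : eqType := {x : R | nonzero_zero_divisor x}.

Definition zdg_edge : rel zdg_vertex := fun x y =>
  (x != y) && `[< exists k : nat, (0 < k)%N /\
     (val x ^+ k * s (val y) = 0 \/ val y ^+ k * s (val x) = 0) >].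

Lemma zdg_edge_sym : symmetric zdg_edge.
Proof.
move=> x y; rewrite /zdg_edge eq_sym; congr (_ && _).
by apply: asbool_equiv_eq; split=> -[k [k0 [h|h]]]; exists k; split=> //;
  [right|left|right|left].
Qed.

Lemma zdg_edge_irr : irreflexive zdg_edge.
Proof. by move=> x; rewrite /zdg_edge eqxx. Qed.

Definition gen_zero_divisor_graph : sgraph :=
  SGraph zdg_edge_sym zdg_edge_irr.

End ZeroDivisorGraph.

Section Transposition.
Variables (R : comPzRingType) (n : nat).

Lemma trmx_mulr (A B : 'M[R]_n) : (A * B)^T = B^T * A^T.
Proof. exact: trmx_mul. Qed.

Definition trmx_involution : involution 'M[R]_n :=
  Involution (@linearD _ _ _ _ (@trmx R n n)) trmx_mulr (@trmxK R n n).

End Transposition.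

(* Main.v *)
(** A nonzero nilpotent element is adjacent to every other vertex, so as soon as
    one exists the graph has a dominating vertex; then it is connected with
    diameter at most 2, and any edge avoiding the dominating vertex yields a
    triangle.  For n >= 2 the matrix unit E_01 is nilpotent.  For n = 1 the ring
    is Z_m, where m / r is nilpotent when r ^ 2 divides m; if m is squarefree,
    connectedness is the classical argument for commutative rings: annihilators
    a of x and b of y give the walk x - ab - y or x - a - b - y. *)
Require Import Defs.
From HB Require Import structures.
From mathcomp Require Import all_boot all_order all_algebra.
From mathcomp Require Import boolp.

Set Implicit Arguments.
Unset Strict Implicit.
Unset Printing Implicit Defensive.

Import GRing.Theory.

Lemma nat_inf_eq (P : nat -> Prop) k :
  P k -> (forall i, P i -> k <= i) -> nat_inf P = Some k.
Proof.
move=> Pk kmin; rewrite /nat_inf; case: pselect => [h|[]]; last first.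
  by exists k; apply/asboolP.
case: ex_minnP => i /asboolP Pi imin; congr Some; apply/eqP.
by rewrite eqn_leq kmin // imin //; apply/asboolP.
Qed.

(** * Walks, distance, diameter and girth in simple graphs *)

Section Graphs.
Variable G : sgraph.
Implicit Types x y z : vertex G.

Definition walk x y := exists2 p, path (@edge G) x p & last x p = y.

Lemma walk_trans y x z : walk x y -> walk y z -> walk x z.
Proof.
move=> [p pp <-] [q pq <-]; exists (p ++ q); last by rewrite last_cat.
by rewrite cat_path pp.
Qed.

(** Walks may repeat vertices, so they compose freely; removing the loops at the end restores the
    uniqueness demanded by [is_path_from_to]. *)
Lemma walk_connected : (forall x y, walk x y) -> connected_graph G.
Proof.
move=> W x y; have [p pp lp] := W x y; move: lp.
case/shortenP: pp => p' pp' up' _ lp.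
by exists p'; rewrite /is_path_from_to pp' lp eqxx.
Qed.

Lemma dist_le x y p : is_path_from_to x y p -> enat_le (dist x y) (Some (size p)).
Proof.
move=> pp; rewrite /dist /nat_inf; case: pselect => [h|[]]; last first.
  by exists (size p); apply/asboolP; exists p.
by case: ex_minnP => i _; apply; apply/asboolP; exists p.
Qed.

Lemma dist_nonadjacent_ge2 x y k :
  x != y -> ~~ edge x y -> enat_le (dist x y) (Some k) -> 1 < k.
Proof.
move=> nxy nexy; rewrite /dist /nat_inf; case: pselect => [h|//].
case: ex_minnP => i /asboolP [p pp <-] _ /=; apply: leq_trans.
(* Length 0 would force [x = y], and length 1 would make [x] and [y] adjacent. *)
move: pp; case: p => [|u [|v p]] //=.
  by rewrite /is_path_from_to /= (negPf nxy).
rewrite /is_path_from_to /= andbT => /and3P [exu /eqP uy _].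
by move: nexy; rewrite -uy exu.
Qed.

Lemma dominated_path z x y : (forall u, u != z -> edge z u) ->
  exists2 p, is_path_from_to x y p & size p <= 2.
Proof.
move=> dom; have [->|nxy] := eqVneq x y.
  by exists [::]; rewrite // /is_path_from_to /= eqxx.
have [xz|nxz] := eqVneq x z.
  exists [:: y] => //; rewrite /is_path_from_to /= eqxx inE nxy.
  by rewrite xz dom // -xz eq_sym.
have [yz|nyz] := eqVneq y z.
  exists [:: y] => //; rewrite /is_path_from_to /= eqxx inE nxy.
  by rewrite edge_sym yz dom.
exists [:: z; y] => //; rewrite /is_path_from_to /= eqxx !inE negb_or nxy nxz.
by rewrite edge_sym !dom // eq_sym nyz.
Qed.

Lemma dominated_connected z :
  (forall u, u != z -> edge z u) -> connected_graph G.
Proof. by move=> dom x y; have [p pp _] := dominated_path x y dom; exists p. Qed.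

Lemma dominated_diam z x y : (forall u, u != z -> edge z u) ->
  x != y -> ~~ edge x y -> diam G = Some 2.
Proof.
move=> dom nxy nexy; apply: nat_inf_eq => [_ [u [v ->]]|k kub].
  have [p /dist_le + ps] := dominated_path u v dom.
  by case: dist => [d|] //= dp; apply: leq_trans dp ps.
by apply: (dist_nonadjacent_ge2 nxy nexy); apply: kub; exists x, y.
Qed.

Lemma dominated_girth z a b : (forall u, u != z -> edge z u) ->
  a != z -> b != z -> edge a b -> girth G = Some 3.
Proof.
move=> dom az bz eab; apply: nat_inf_eq => [|k [c _ [c3 <-]] //].
exists [:: z; a; b] => //; rewrite /ucycle /= !inE negb_or dom // eab.
rewrite edge_sym dom // ![z == _]eq_sym az bz.
by rewrite /= andbT; apply: contraTneq eab => ->; rewrite edge_irr.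
Qed.

End Graphs.

Local Open Scope ring_scope.

(** * Graphs of rings with involution *)

Section ZeroDivisorGraphs.
Variables (R : pzRingType) (s : involution R).
Local Notation G := (gen_zero_divisor_graph s).

Lemma zero_divisorl (x y : R) :
  x != 0 -> y != 0 -> x * y = 0 -> nonzero_zero_divisor x.
Proof.
move=> x0 y0 xy; rewrite /nonzero_zero_divisor x0; apply/asboolP.
by exists y; split=> //; left.
Qed.

Lemma zero_divisorr (x y : R) :
  x != 0 -> y != 0 -> y * x = 0 -> nonzero_zero_divisor x.
Proof.
move=> x0 y0 yx; rewrite /nonzero_zero_divisor x0; apply/asboolP.
by exists y; split=> //; right.
Qed.

Lemma nilpotent_dominates (z : vertex G) :
  val z ^+ 2 = 0 -> forall u : vertex G, u != z -> edge z u.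
Proof.
move=> z2 u uz; rewrite /= /zdg_edge eq_sym uz; apply/asboolP.
(* The exponent in the adjacency relation does the work: [z ^+ 2 * s u] vanishes whatever [u] is. *)
by exists 2%N; split=> //; left; rewrite z2 mul0r.
Qed.

Lemma nilpotent_connected (z : R) :
  z != 0 -> z ^+ 2 = 0 -> connected_graph G.
Proof.
move=> z0 z2; have zz : nonzero_zero_divisor z.
  by apply: (@zero_divisorl z z); rewrite -?expr2.
by apply/(dominated_connected (@nilpotent_dominates (exist _ z zz) _)).
Qed.

(** Here [z] dominates, the non-adjacent pair [x], [y] excludes diameter below 2, and the edge
    between [a] and [b] closes a triangle with [z]. *)
Lemma nilpotent_diam_girth (z x y a b : R) :
  z != 0 -> z ^+ 2 = 0 ->
  nonzero_zero_divisor x -> nonzero_zero_divisor y -> x != y ->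
  (forall k, (0 < k)%N -> x ^+ k * s y != 0 /\ y ^+ k * s x != 0) ->
  nonzero_zero_divisor a -> nonzero_zero_divisor b ->
  a != b -> a != z -> b != z -> a * s b = 0 ->
  diam G = Some 2%N /\ girth G = Some 3%N.
Proof.
move=> z0 z2 zx zy nxy nexy za zb nab naz nbz ab.
have zz : nonzero_zero_divisor z.
  by apply: (@zero_divisorl z z); rewrite -?expr2.
have dom := @nilpotent_dominates (exist _ z zz) z2.
split.
  apply: (@dominated_diam G _ (exist _ x zx) (exist _ y zy) dom nxy).
  rewrite /= /zdg_edge negb_and; apply/orP; right; apply/asboolPn.
  by move=> [k [/nexy [/eqP ? /eqP ?] []]].
apply: (@dominated_girth G _ (exist _ a za) (exist _ b zb) dom) => //.
rewrite /= /zdg_edge; apply/andP; split=> //; apply/asboolP.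
by exists 1%N; split=> //; left; rewrite expr1.
Qed.

Lemma commutative_connected :
  commutative (@GRing.mul R) -> s =1 id -> connected_graph G.
Proof.
move=> mC sid; apply: walk_connected.
(* A walk rather than an edge: the graph has no loops, so the empty walk covers [x = y]. *)
have adj (x y : vertex G) : val x * val y = 0 -> walk x y.
  move=> xy; have [->|nxy] := eqVneq x y; first by exists [::].
  exists [:: y] => //=; rewrite andbT /zdg_edge nxy; apply/asboolP.
  by exists 1%N; split=> //; left; rewrite expr1 sid.
have annihilator (x : vertex G) : exists2 a, a != 0 & val x * a = 0.
  have /andP [_ /asboolP [a [a0 h]]] := valP x.
  by exists a => //; case: h => // h; rewrite mC.
move=> x y; have [a a0 xa] := annihilator x; have [b b0 yb] := annihilator y.
have /andP [x0 _] := valP x; have /andP [y0 _] := valP y.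
have za := zero_divisorr a0 x0 xa; have zb := zero_divisorr b0 y0 yb.
(* If [a * b] is nonzero, it is itself a vertex annihilated by both ends. *)
have [ab0|ab0] := eqVneq (a * b) 0.
  apply: (@walk_trans G (exist _ a za)); first exact: adj.
  apply: (@walk_trans G (exist _ b zb)); first exact: adj.
  by apply: adj; rewrite /= mC.
have xab : val x * (a * b) = 0 by rewrite mulrA xa mul0r.
apply: (@walk_trans G (exist _ (a * b) (zero_divisorr ab0 x0 xab))).
  exact: adj.
by apply: adj; rewrite /= -mulrA [b * _]mC yb mulr0.
Qed.

End ZeroDivisorGraphs.

(** * Matrices of size at least 2 *)

Section LargeMatrices.
Variables (R : comNzRingType) (n : nat).
Local Notation M := 'M[R]_n.+2.
Local Notation G := (gen_zero_divisor_graph (trmx_involution R n.+2)).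

Let E (i j : 'I_n.+2) : M := delta_mx i j.

Let mulE i j k l : E i j * E k l = E i l *+ (j == k).
Proof. exact: mul_delta_mx_cond. Qed.

Let E_inj i j k l : E i j = E k l -> (i == k) && (j == l).
Proof.
move=> /matrixP /(_ i j) /eqP; rewrite !mxE !eqxx.
by case: ((i == k) && (j == l)) => //=; rewrite oner_eq0.
Qed.

Let E_neq0 i j : E i j != 0.
Proof.
by apply/eqP => /matrixP /(_ i j) /eqP; rewrite !mxE !eqxx oner_eq0.
Qed.

Let E01_sq : E 0 1 ^+ 2 = 0.
Proof. by rewrite expr2 mulE. Qed.

Lemma matrix_graph_connected : connected_graph G.
Proof. exact: nilpotent_connected (E_neq0 0 1) E01_sq. Qed.

Lemma matrix_graph_diam_girth : diam G = Some 2%N /\ girth G = Some 3%N.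
Proof.
have idem (A : M) k : A * A = A -> (0 < k)%N -> A ^+ k = A.
  by move=> AA; case: k => // k _; elim: k => // k IH; rewrite exprS IH.
have zE i : nonzero_zero_divisor (E i i).
  have [->|i0] := eqVneq i 0.
    by apply: (zero_divisorl (E_neq0 _ _) (E_neq0 1 1)); rewrite mulE.
  by apply: (zero_divisorl (E_neq0 _ _) (E_neq0 0 0)); rewrite mulE (negPf i0).
(* [E 0 0] and [B] are distinct idempotents, so taking powers changes nothing, and each times the
   transpose of the other is [E 0 0]; hence they are not adjacent. *)
pose B := E 0 0 + E 0 1.
have E00B : E 0 0 * B^T = E 0 0.
  by rewrite /B linearD /= !trmx_delta mulrDr !mulE addr0.
have BE00 : B * (E 0 0)^T = E 0 0.
  by rewrite /B trmx_delta mulrDl !mulE addr0.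
have BB : B * B = B.
  by rewrite /B mulrDl !mulrDr !mulE !addr0.
have B0 : B != 0.
  by apply: contraTneq (E_neq0 0 0) => B0; rewrite -BE00 B0 mul0r eqxx.
have zB : nonzero_zero_divisor B.
  by apply: (zero_divisorr B0 (E_neq0 1 1)); rewrite /B mulrDr !mulE addr0.
apply: (@nilpotent_diam_girth _ _ (E 0 1) (E 0 0) B (E 0 0) (E 1 1)) => //.
- by rewrite eq_sym -subr_eq0 /B addrC addKr.
- move=> k k0; rewrite !idem //.
  by rewrite /= E00B BE00.
- by apply/eqP => /E_inj.
- by apply/eqP => /E_inj.
- by apply/eqP => /E_inj.
- by rewrite /= trmx_delta mulE.
Qed.

End LargeMatrices.

(** * Matrices of size 1: a commutative ring with trivial involution *)

Section OneByOneMatrices.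
Variable R : comPzRingType.
Local Notation G := (gen_zero_divisor_graph (trmx_involution R 1)).

Lemma mx11_graph_connected : connected_graph G.
Proof.
apply: commutative_connected => [A B|A] /=.
  by rewrite [A]mx11_scalar [B]mx11_scalar; exact: scalar_mxC.
by rewrite [A]mx11_scalar tr_scalar_mx.
Qed.

End OneByOneMatrices.

(** * Diameter and girth for size 1, by divisibility in the natural numbers *)

Section Zm.
Variables (m : nat) (m1 : (1 < m)%N).
Local Notation G := (gen_zero_divisor_graph (trmx_involution 'Z_m 1)).

Let N (k : nat) : 'M['Z_m]_1 := (k%:R)%:M.

Let N_eq i j : (N i == N j) = (i == j %[mod m]).
Proof.
apply/eqP/eqP => [/matrixP /(_ 0 0)|ij].
  by rewrite !mxE !mulr1n => /(congr1 val); rewrite /= !val_Zp_nat.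
by congr (_%:M); apply: val_inj; rewrite /= !val_Zp_nat.
Qed.

Let N_eq0 i : (N i == 0) = (m %| i)%N.
Proof.
by rewrite -(_ : N 0 = 0) ?N_eq ?mod0n // /N raddf0.
Qed.

Let mulN i j : N i * N j = N (i * j).
Proof. by rewrite /N natrM scalar_mxM. Qed.

Let expN i k : (0 < k)%N -> N i ^+ k = N (i ^ k).
Proof.
case: k => // k _; elim: k => [|k IH]; first by rewrite expn1.
by rewrite exprS IH mulN -expnS.
Qed.

Let trN i : (N i)^T = N i.
Proof. exact: tr_scalar_mx. Qed.

(** The nilpotent vertex is [m %/ r]. The vertices [r] and [r ^ 2] are not adjacent, because every
    product to be tested is a power of [r], which [q], and hence [m], does not divide. The triangle
    is completed by [q] and [m %/ q], whose product is [m]. *)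
Lemma Zm_graph_diam_girth (r q : nat) :
  prime r -> prime q -> q != r -> (r ^ 2 %| m)%N -> (q %| m)%N ->
  diam G = Some 2%N /\ girth G = Some 3%N.
Proof.
move=> pr pq nqr r2m qm.
have m0 : (0 < m)%N := ltnW m1.
have rm : (r %| m)%N by apply: dvdn_trans r2m; rewrite dvdn_exp.
have r0 := prime_gt0 pr; have q0 := prime_gt0 pq.
have [r1 q1] := (prime_gt1 pr, prime_gt1 pq).
have cofactor_lt d : (1 < d)%N -> (m %/ d < m)%N by move=> d1; rewrite ltn_Pdiv.
have cofactor_gt0 d : (0 < d)%N -> (d %| m)%N -> (0 < m %/ d)%N.
  by move=> d0 dm; rewrite divn_gt0 // dvdn_leq.
have Ncof d : (1 < d)%N -> (d %| m)%N -> N (m %/ d) != 0.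
  by move=> d1 dm; rewrite N_eq0 gtnNdvd ?cofactor_gt0 ?cofactor_lt // ltnW.
have q_ndvd_r k : ~~ (q %| r ^ k)%N.
  by rewrite Euclid_dvdX // dvdn_prime2 // (negPf nqr).
have Nrk k : N (r ^ k) != 0.
  by rewrite N_eq0; apply: contra (q_ndvd_r k); exact: dvdn_trans.
have rcof : (r %| m %/ r)%N by rewrite dvdn_divRL // mulnn.
have rcofq : (r %| m %/ q)%N.
  by rewrite dvdn_divRL // Gauss_dvd ?rm // prime_coprime // dvdn_prime2 // eq_sym.
have r_ndvd_q : ~~ (r %| q)%N by rewrite dvdn_prime2 // eq_sym.
have Nq0 : N q != 0.
  by rewrite N_eq0; apply: contra r_ndvd_q; exact: dvdn_trans.
(* Since [r] divides [m], a congruence modulo [m] descends to one modulo [r]. *)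
have neq_r i j : (r %| i)%N -> ~~ (r %| j)%N -> N j != N i.
  move=> ri; apply: contraNneq => /eqP; rewrite N_eq => /eqP ij.
  have /(congr1 (modn^~ r)) := ij; rewrite /= !modn_dvdm // => jr.
  by rewrite /dvdn jr.
have NmE i j : (m %| i * j)%N -> N i * N j = 0.
  by move=> mij; apply/eqP; rewrite mulN N_eq0.
apply: (@nilpotent_diam_girth _ _ (N (m %/ r)) (N (r ^ 1)) (N (r ^ 2))
         (N q) (N (m %/ q))) => //.
- exact: Ncof.
(* Writing one factor [m %/ r] as a multiple of [r] turns the square into a multiple of [m]. *)
- by rewrite expr2 NmE // -{2}(divnK rcof) mulnCA divnK // dvdn_mull.
- by apply: (@zero_divisorl _ _ (N (m %/ r))); rewrite ?Ncof ?NmE // expn1 mulnC divnK.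
- apply: (@zero_divisorl _ _ (N (m %/ r))); rewrite ?Ncof ?NmE //.
  by rewrite -mulnn -mulnA dvdn_mull // mulnC divnK.
(* If [r] and [r ^ 2] agreed modulo [m], then [r ^ 2] would divide [r * (r - 1)], so [r] would
   divide [r - 1]. *)
- rewrite N_eq eq_sym eqn_mod_dvd ?leq_exp2l // expn1.
  apply/negP => /(dvdn_trans r2m).
  rewrite -mulnn -{5}[r]muln1 -mulnBr dvdn_pmul2l // gtnNdvd ?subn_gt0 //.
  by rewrite subn1 prednK.
- by move=> k k0; rewrite /= !trN !expN // !mulN -!expnM -!expnD; split.
- by apply: (@zero_divisorl _ _ (N (m %/ q))); rewrite ?Ncof ?NmE // mulnC divnK.
- by apply: (@zero_divisorr _ _ (N q)); rewrite ?Ncof ?NmE // mulnC divnK.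
- exact: neq_r.
- exact: neq_r.
(* Both cofactors are below [m], so congruence means equality, which forces [q = r]. *)
- rewrite N_eq !modn_small ?cofactor_lt //; apply: contraNneq nqr => e.
  by rewrite -(eqn_pmul2l (cofactor_gt0 q q0 qm)) {2}e !divnK.
- by rewrite /= trN NmE // mulnC divnK.
Qed.

End Zm.

Lemma prime_divisor_neq (m r : nat) : (1 < size (primes m))%N ->
  exists q, [/\ prime q, q != r & (q %| m)%N].
Proof.
case E: (primes m) => [|p [|q t]] // _.
have := primes_uniq m; rewrite E /= inE negb_or => /andP[/andP[npq _] _].
have in_primes u : u \in primes m -> prime u /\ (u %| m)%N.
  by rewrite mem_primes => /and3P[].
have [pp pm] : prime p /\ (p %| m)%N by apply: in_primes; rewrite E mem_head.
have [qp qm] : prime q /\ (q %| m)%N.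
  by apply: in_primes; rewrite E !inE eqxx orbT.
have [pr|npr] := eqVneq p r; last by exists p.
by exists q; split; rewrite // -pr eq_sym.
Qed.

Close Scope ring_scope.

Theorem theorem2p12 (n m : nat) (hn : 0 < n) (hm : 1 < m) :
  let G := gen_zero_divisor_graph (trmx_involution 'Z_m n) in
  connected_graph G /\
  ((n = 1 -> 1 < size (primes m) /\ exists p, prime p /\ p ^ 2 %| m) ->
   diam G = Some 2 /\ girth G = Some 3).
Proof.
case: n hn => [//|[|n]] _ /=; last first.
  split=> [|_]; first exact: matrix_graph_connected.
  exact: matrix_graph_diam_girth.
split=> [|/(_ erefl) [pm [r [pr r2m]]]]; first exact: mx11_graph_connected.
have [q [pq nqr qm]] := prime_divisor_neq r pm.
exact: Zm_graph_diam_girth pr pq nqr r2m qm.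
Qed.
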